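(* Let $R$ be a nonzero ring, $p$ a prime, and $G$ a $p$-group. Suppose that the group ring $RG$ is a $W\sqrt{J}U$ ring and that $3\in J(R)$. Then $G$ is a $3$-group.
   Context: Rings are associative with identity, not necessarily commutative. For a ring $A$, $U(A)$ is its group of units, $J(A)$ its Jacobson radical, and $\sqrt{J(A)}=\{x\in A : x^n\in J(A)\text{ for some } n\ge 1\}$. A ring $A$ is $W\sqrt{J}U$ (weakly $\sqrt{J}U$) if $U(A)=\pm 1+\sqrt{J(A)}$; equivalently, every unit of $A$ can be written as $j+1$ or as $j-1$ for some $j\in\sqrt{J(A)}$. For a prime $q$, a $q$-group is a (possibly infinite) group in which every element has order a power of $q$ (so the trivial group is a $q$-group for every $q$). The integer $3$ is regarded as the element $3\cdot 1_R$ of $R$. *)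

(* Defs.v *)
From HB Require Import structures.
From mathcomp Require Import all_boot all_algebra finmap.
From mathcomp Require Import monalg.

Set Implicit Arguments.
Unset Strict Implicit.
Unset Printing Implicit Defensive.

Import GRing.Theory.

Local Open Scope fset_scope.
Local Open Scope ring_scope.

(* The group ring RG: finitely supported functions G -> R with convolution.
   The ring structure of monalg on {malg R[K]} is only available when K has no
   nontrivial units, so the one on a group has its own carrier alias. *)
Definition group_ring (R : nzRingType) (G : groupType) : Type := {malg R[G]}.

HB.instance Definition _ (R : nzRingType) (G : groupType) :=
  GRing.Zmodule.copy (group_ring R G) {malg R[G]}.

Section GroupRing.
Context (R : nzRingType) (G : groupType).

Implicit Types (a b c : group_ring R G).

Definition gr_single (r : R) (g : G) : group_ring R G := << r *g g >>.

Definition gr_one : group_ring R G := gr_single 1 1%g.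

Definition gr_mul a b : group_ring R G :=
  \sum_(g <- msupp a) \sum_(h <- msupp b) gr_single (a@_g * b@_h) (g * h)%g.

Lemma gr_mulw (d1 d2 : {fset G}) a b : msupp a `<=` d1 -> msupp b `<=` d2 ->
  gr_mul a b =
    \sum_(g <- d1) \sum_(h <- d2) gr_single (a@_g * b@_h) (g * h)%g.
Proof.
move=> le_d1 le_d2; rewrite /gr_mul /gr_single (big_fset_incl _ le_d1) /=.
  apply/eq_bigr=> k1 _; apply/big_fset_incl => // k _ /mcoeff_outdom ->.
  by rewrite mulr0 monalgU0.
move=> k _ /mcoeff_outdom g1k.
by rewrite big1 => // k' _; rewrite g1k mul0r monalgU0.
Qed.

Lemma gr_mul0g : left_zero 0 gr_mul.
Proof. by move=> a; rewrite /gr_mul msupp0 big_seq_fset0. Qed.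

Lemma gr_mulg0 : right_zero 0 gr_mul.
Proof.
by move=> a; rewrite /gr_mul big1 // => g _; rewrite msupp0 big_seq_fset0.
Qed.

Lemma gr_mulUg r g b :
  gr_mul (gr_single r g) b =
    \sum_(h <- msupp b) gr_single (r * b@_h) (g * h)%g.
Proof.
rewrite (gr_mulw msuppU_le (fsubset_refl _)) big_seq_fset1.
by apply/eq_bigr => h _; rewrite mcoeffUU.
Qed.

Lemma gr_mulgU r h a :
  gr_mul a (gr_single r h) =
    \sum_(g <- msupp a) gr_single (a@_g * r) (g * h)%g.
Proof.
rewrite (gr_mulw (fsubset_refl _) msuppU_le).
by apply/eq_bigr => g _; rewrite big_seq_fset1 mcoeffUU.
Qed.

Lemma gr_mulUU r s g h :
  gr_mul (gr_single r g) (gr_single s h) = gr_single (r * s) (g * h)%g.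
Proof. by rewrite (gr_mulw msuppU_le msuppU_le) !big_seq_fset1 !mcoeffUU. Qed.

Lemma gr_mul1g : left_id gr_one gr_mul.
Proof.
move=> a; rewrite gr_mulUg [RHS]monalgE.
by apply/eq_bigr=> g _; rewrite mul1r mul1g.
Qed.

Lemma gr_mulg1 : right_id gr_one gr_mul.
Proof.
move=> a; rewrite gr_mulgU [RHS]monalgE.
by apply/eq_bigr=> g _; rewrite mulr1 mulg1.
Qed.

Lemma gr_mulDl : left_distributive gr_mul +%R.
Proof.
move=> a b c.
rewrite [in RHS](gr_mulw (fsubsetUl _ (msupp b)) (fsubset_refl _)).
rewrite [in RHS](gr_mulw (fsubsetUr (msupp a) _) (fsubset_refl _)).
rewrite (gr_mulw (msuppD_le _ _) (fsubset_refl _)).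
rewrite -big_split /=; apply/eq_bigr=> g _.
rewrite -big_split /=; apply/eq_bigr=> h _.
by rewrite mcoeffD mulrDl /gr_single monalgUD.
Qed.

Lemma gr_mulDr : right_distributive gr_mul +%R.
Proof.
move=> a b c.
rewrite [in RHS](gr_mulw (fsubset_refl _) (fsubsetUl _ (msupp c))).
rewrite [in RHS](gr_mulw (fsubset_refl _) (fsubsetUr (msupp b) _)).
rewrite (gr_mulw (fsubset_refl _) (msuppD_le _ _)).
rewrite -big_split /=; apply/eq_bigr=> g _.
rewrite -big_split /=; apply/eq_bigr=> h _.
by rewrite mcoeffD mulrDr /gr_single monalgUD.
Qed.

Lemma gr_mulA : associative gr_mul.
Proof.
have sumL (I : Type) (s : seq I) F c :
    gr_mul (\sum_(i <- s) F i) c = \sum_(i <- s) gr_mul (F i) c.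
  exact: (big_morph (gr_mul^~ c) (fun _ _ => gr_mulDl _ _ _) (gr_mul0g _)).
have sumR (I : Type) (s : seq I) F a :
    gr_mul a (\sum_(i <- s) F i) = \sum_(i <- s) gr_mul a (F i).
  exact: (big_morph (gr_mul a) (fun _ _ => gr_mulDr _ _ _) (gr_mulg0 _)).
have decomp a : a = \sum_(g <- msupp a) gr_single a@_g g by exact: monalgE.
move: gr_mulUU sumL sumR; generalize gr_mul => mul mulUU sumL sumR.
move=> a b c; rewrite (decomp a) !sumL; apply/eq_bigr=> g _.
rewrite (decomp b) sumL !sumR sumL; apply/eq_bigr=> h _.
rewrite (decomp c) !sumR; apply/eq_bigr=> k _.
by rewrite !mulUU mulrA mulgA.
Qed.

Lemma gr_one_neq0 : gr_one != 0.
Proof. by rewrite monalgU_eq0 oner_eq0. Qed.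

HB.instance Definition _ := GRing.Zmodule_isNzRing.Build (group_ring R G)
  gr_mulA gr_mul1g gr_mulg1 gr_mulDl gr_mulDr gr_one_neq0.

End GroupRing.

Section RingNotions.
Context (A : pzRingType).

Definition is_ring_unit (u : A) : Prop := exists v : A, u * v = 1 /\ v * u = 1.

Definition left_ideal (I : A -> Prop) : Prop :=
  [/\ I 0, forall x y, I x -> I y -> I (x + y) & forall a x, I x -> I (a * x)].

Definition maximal_left_ideal (M : A -> Prop) : Prop :=
  [/\ left_ideal M, ~ M 1 &
      forall I : A -> Prop, left_ideal I -> (forall x, M x -> I x) -> ~ I 1 ->
        forall x, I x -> M x].

Definition jacobson (x : A) : Prop :=
  forall M : A -> Prop, maximal_left_ideal M -> M x.

Definition sqrt_jacobson (x : A) : Prop :=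
  exists n : nat, (1 <= n)%N /\ jacobson (x ^+ n).

Definition WsqrtJU : Prop :=
  forall u : A, is_ring_unit u <->
    exists j : A, sqrt_jacobson j /\ (u = 1 + j \/ u = - 1 + j).

End RingNotions.

Section GroupNotions.
Context (G : groupType).

Definition has_order (x : G) (m : nat) : Prop :=
  [/\ (0 < m)%N, (x ^+ m)%g = 1%g &
      forall k : nat, (0 < k)%N -> (x ^+ k)%g = 1%g -> (m <= k)%N].

Definition is_pgroup (q : nat) : Prop :=
  forall x : G, exists n : nat, has_order x (q ^ n).

End GroupNotions.

(* Main.v *)
Require Import Defs.
From mathcomp Require Import all_boot all_algebra monalg.
From mathcomp Require Import boolp classical_sets.

(** Let g be an element of G, of order m = p ^ k, with p different from 3; then
    g = 1, for the following reason.

    Being prime to 3, the integer m is congruent to 1 or -1 modulo 3, and 3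
    lies in J(R), so m is invertible in R, hence in RG
    ([natr_left_inverse], [natr_left_inverse_group_ring]).  Whenever
    x ^ m = 1 and m is invertible, x - 1 can be in the square root of the
    radical only if x = 1 ([sqrt_jacobson_torsion]): the element
    e = (1 + x + ... + x ^ (m - 1)) / m is an idempotent killed by x - 1, and
    its complement 1 - e is a multiple of x - 1 commuting with it, so that
    1 - e = (1 - e) ^ n falls in J for large n; an idempotent of J is 0, hence
    e = 1 and x - 1 = (x - 1) e = 0.

    As g is a unit of RG, either g - 1 or g + 1 is in the square root of
    J(RG).  The former gives g = 1 at once.  In the latter case
    g ^ 2 - 1 = (g - 1) (g + 1) is there as well, so g ^ 2 = 1; then
    (- g) ^ 2 = 1 and - g - 1 is there too, so - g = 1 because 2 is
    invertible; but 1 and g are linearly independent in RG unless g = 1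
    ([group_ring_of_eqN1]).

    The one fact about the radical that requires work is that 1 - x has a left
    inverse for x in the radical ([jacobson_left_inverse]), which depends on
    the existence of maximal left ideals ([proper_left_ideal_sub_maximal]). *)

Set Implicit Arguments.
Unset Strict Implicit.
Unset Printing Implicit Defensive.

Import GRing.Theory.

Local Open Scope ring_scope.

(** * The Jacobson radical *)

Section Jacobson.
Context (A : pzRingType).
Implicit Types (x y : A) (L M : A -> Prop).

Lemma proper_left_ideal_sub_maximal L : left_ideal L -> ~ L 1 ->
  exists M, maximal_left_ideal M /\ forall x, L x -> M x.
Proof.
move=> idL properL; have [L0 LD LM] := idL.
(* Zorn's lemma is applied to the sets X whose union with L is a proper left
   ideal, rather than to the proper left ideals containing L, so that the
   union of the empty chain still qualifies. *)
pose P : set (set A) :=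
  fun X => left_ideal (fun z => L z \/ X z) /\ ~ (L 1 \/ X 1).
have [|X [[idX properX] maxX]] := @Zorn_bigcup A P.
  move=> F FP chainF; split; last first.
    case=> [//|[X FX X1]]; have [_ notX1] := FP _ FX.
    by apply: notX1; right.
  split; first by left.
    move=> x y [Lx|[X FX Xx]] [Ly|[Y FY Yy]].
    - by left; apply: LD.
    - have [[_ YD _] _] := FP _ FY.
      by case: (YD x y (or_introl Lx) (or_intror Yy)) => ?;
        [left | right; exists Y].
    - have [[_ XD _] _] := FP _ FX.
      by case: (XD x y (or_intror Xx) (or_introl Ly)) => ?;
        [left | right; exists X].
    have [XY|YX] := chainF X Y FX FY.
      have [[_ YD _] _] := FP _ FY.
      by case: (YD x y (or_intror (XY _ Xx)) (or_intror Yy)) => ?;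
        [left | right; exists Y].
    have [[_ XD _] _] := FP _ FX.
    by case: (XD x y (or_intror Xx) (or_intror (YX _ Yy))) => ?;
      [left | right; exists X].
  move=> a x [Lx|[X FX Xx]]; first by left; apply: LM.
  have [[_ _ XM] _] := FP _ FX.
  by case: (XM a x (or_intror Xx)) => ?; [left | right; exists X].
exists (fun z => L z \/ X z); split; last by move=> x; left.
split=> // I idI sub_I properI x Ix; apply: contrapT => notMx.
apply: (maxX I).
  split=> [y Xy|IX]; first by apply: sub_I; right.
  by apply: notMx; right; apply: IX.
have LI : (fun z => L z \/ I z) = I.
  apply/funext => z; apply/propext; split=> [[Lz|//]|]; last by right.
  by apply: sub_I; left.
split; first by rewrite LI.
by case=> // L1; apply: properL.
Qed.

Lemma jacobson_left_ideal : left_ideal (@jacobson A).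
Proof.
split=> [M|x y Jx Jy M|a x Jx M] maxM; have [[M0 MD MM] _ _] := maxM => //.
  by apply: MD; [apply: Jx | apply: Jy].
by apply: MM; apply: Jx.
Qed.

(** If 1 - x generated a proper left ideal, a maximal left ideal containing it
    would contain x as well, and therefore 1. *)
Lemma jacobson_left_inverse x : jacobson x -> exists c, c * (1 - x) = 1.
Proof.
move=> Jx; apply: contrapT => noinv.
pose L z := exists a, z = a * (1 - x).
have idL : left_ideal L.
  split; first by exists 0; rewrite mul0r.
    by move=> _ _ [a ->] [b ->]; exists (a + b); rewrite mulrDl.
  by move=> b _ [a ->]; exists (b * a); rewrite mulrA.
have [|M [maxM LM]] := proper_left_ideal_sub_maximal idL.
  by case=> a a1; apply: noinv; exists a.
have [[_ MD _] M1 _] := maxM; apply: M1.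
rewrite -[1](subrK x); apply: MD; last exact: Jx.
by apply: LM; exists 1; rewrite mul1r.
Qed.

Lemma natr_left_inverse (n : nat) :
  jacobson (3%:R : A) -> coprime n 3 -> exists c : A, c * n%:R = 1.
Proof.
have [_ _ JM] := jacobson_left_ideal; move=> J3.
rewrite (divn_eq n 3) /coprime gcdnC gcdnMDl.
have: (n %% 3 < 3)%N by rewrite ltn_pmod.
set k := (n %/ 3)%N; case: (n %% 3)%N => [|[|[|//]]] // _ _.
  have [c c1] := jacobson_left_inverse (JM (- k%:R) _ J3).
  by exists c; rewrite natrD natrM addrC -[k%:R * _]opprK -mulNr.
have [c c1] := jacobson_left_inverse (JM k.+1%:R _ J3).
have -> : (k * 3 + 2)%:R = k.+1%:R * 3%:R - 1 :> A.
  by apply: (addIr 1); rewrite subrK natr1 -natrM mulSn addnC.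
by exists (- c); rewrite mulNr -mulrN opprB.
Qed.

Lemma sqrt_jacobsonM x y : GRing.comm x y -> sqrt_jacobson y ->
  sqrt_jacobson (x * y).
Proof.
have [_ _ JM] := jacobson_left_ideal.
move=> cxy [n [n_gt0 Jyn]]; exists n; split=> //.
by rewrite exprMn_comm //; apply: JM.
Qed.

(** With w = 1 + x + ... + x ^ (m - 1) and f = m - w, this is the idempotent
    argument cleared of its denominators.  As f multiplies x - 1 by m, the
    element 1 - c ^ n f ^ n kills x - 1 for all n; as f is a multiple of
    x - 1, f ^ n is in J for some n, and then that element is left
    invertible. *)
Lemma sqrt_jacobson_torsion (m : nat) (c x : A) :
  c * m%:R = 1 -> x ^+ m = 1 -> sqrt_jacobson (x - 1) -> x = 1.
Proof.
have [_ _ JM] := jacobson_left_ideal.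
move=> cm xm1 Jx; apply/eqP; rewrite -subr_eq0; apply/eqP.
pose w := \sum_(i < m) x ^+ i; pose f := m%:R - w.
have comm_x i : GRing.comm (x - 1) (x ^+ i).
  apply: commrX; apply: commr_sym; apply: commrB => //; exact: commr1.
have comm_w : GRing.comm (x - 1) w by apply: commr_sum.
have fx : f * (x - 1) = m%:R * (x - 1).
  by rewrite /f mulrBl -comm_w -subrX1 xm1 subrr subr0.
have [q [cq fq]] : exists q, GRing.comm q (x - 1) /\ f = q * (x - 1).
  exists (- \sum_(i < m) \sum_(j < i) x ^+ j); split.
    apply: commr_sym; apply: commrN; apply: commr_sum => i _; exact: commr_sum.
  rewrite mulNr mulr_suml -sumrN /f /w -[m in m%:R]card_ord -sum1_card natr_sum.
  rewrite -sumrB; apply: eq_bigr => i _.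
  rewrite -opprB subrX1; congr (- _); apply: commr_sum => j _; exact: comm_x.
have [n [_ Jfn]] : sqrt_jacobson f by rewrite fq; apply: sqrt_jacobsonM.
have fnx : f ^+ n * (x - 1) = m%:R ^+ n * (x - 1).
  elim: n {Jfn} => [|n IHn]; first by rewrite !expr0.
  by rewrite exprSr -mulrA fx mulrA (commr_nat _ m) -mulrA IHn mulrA -exprS.
have cmn : c ^+ n * m%:R ^+ n = 1.
  by rewrite -exprMn_comm ?cm ?expr1n //; apply: commr_nat.
have [d d1] := jacobson_left_inverse (JM (c ^+ n) _ Jfn).
have killed : (1 - c ^+ n * f ^+ n) * (x - 1) = 0.
  by rewrite mulrBl mul1r -mulrA fnx mulrA cmn mul1r subrr.
by rewrite -[LHS]mul1r -{1}d1 -mulrA killed mulr0.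
Qed.

End Jacobson.

(** * Group elements in the group ring *)

Section GroupRing.
Context (R : nzRingType) (G : groupType).
Implicit Types g h : G.

Definition group_ring_of g : group_ring R G := gr_single 1 g.

Lemma group_ring_of1 : group_ring_of 1%g = 1.
Proof. by []. Qed.

Lemma group_ring_ofM g h :
  group_ring_of (g * h)%g = group_ring_of g * group_ring_of h.
Proof. by rewrite /group_ring_of [RHS]gr_mulUU mulr1. Qed.

Lemma group_ring_ofX g n : group_ring_of (g ^+ n)%g = group_ring_of g ^+ n.
Proof.
elim: n => [|n IHn]; first exact: group_ring_of1.
by rewrite expgS exprS group_ring_ofM IHn.
Qed.

Lemma group_ring_of_unit g : is_ring_unit (group_ring_of g).
Proof.
by exists (group_ring_of g^-1%g); rewrite -!group_ring_ofM mulgV mulVg.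
Qed.

Lemma group_ring_of_eq1 g : group_ring_of g = 1 -> g = 1%g.
Proof.
move=> /(congr1 (mcoeff 1%g)); rewrite /group_ring_of /gr_single.
rewrite -group_ring_of1 /group_ring_of /gr_single !mcoeffU eqxx.
by case: eqP => // _ /eqP; rewrite eq_sym oner_eq0.
Qed.

Lemma group_ring_of_eqN1 g : group_ring_of g = -1 -> g = 1%g.
Proof.
move=> /(congr1 (mcoeff 1%g)); rewrite mcoeffN.
rewrite -group_ring_of1 /group_ring_of /gr_single !mcoeffU eqxx.
by case: eqP => // _ /eqP; rewrite eq_sym oppr_eq0 oner_eq0.
Qed.

Lemma natr_left_inverse_group_ring (n : nat) :
  jacobson (3%:R : R) -> coprime n 3 ->
  exists c : group_ring R G, c * n%:R = 1.
Proof.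
move=> J3 /(natr_left_inverse J3)[c c1]; exists (gr_single c 1%g).
by rewrite mulr_natr /gr_single -monalgUMn -mulr_natr c1.
Qed.

Lemma torsion_coprime3_eq1 (m : nat) (g : G) :
  WsqrtJU (group_ring R G) -> jacobson (3%:R : R) -> coprime m 3 ->
  (g ^+ m)%g = 1%g -> g = 1%g.
Proof.
move=> WRG J3 m3 gm1.
have [c cm] := natr_left_inverse_group_ring J3 m3.
have [c2 c2_inv] := natr_left_inverse_group_ring J3 (isT : coprime 2 3).
set x := group_ring_of g.
have xm1 : x ^+ m = 1 by rewrite -group_ring_ofX gm1.
have [j [Jj]] := (WRG x).1 (group_ring_of_unit g).
case=> [xE|xE].
  apply: group_ring_of_eq1; apply: (sqrt_jacobson_torsion cm xm1).
  by rewrite -/x xE addrAC subrr add0r.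
(* Here x + 1 is in the square root of the radical; the torsion lemma applies
   to x ^ 2 with exponent m, and then to - x with exponent 2. *)
have jE : j = x + 1 by rewrite xE addrAC addNr add0r.
have x2 : x ^+ 2 = 1.
  apply: (sqrt_jacobson_torsion cm); first by rewrite exprAC xm1 expr1n.
  rewrite subrX1 big_ord_recr big_ord1 /= expr0 expr1 [1 + x]addrC -jE.
  apply: sqrt_jacobsonM => //; rewrite jE.
  apply: commrD; last exact: commr1.
  apply: commr_sym; apply: commrB => //; exact: commr1.
have Nx1 : - x = 1.
  apply: (sqrt_jacobson_torsion c2_inv); first by rewrite sqrrN.
  rewrite -opprD -jE -mulN1r; apply: sqrt_jacobsonM => //.
  by apply: commr_sym; exact: commrN1.
by apply: group_ring_of_eqN1; rewrite -Nx1 opprK.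
Qed.

End GroupRing.

Theorem lemma3p4 (R : nzRingType) (p : nat) (G : groupType)
  (p_prime : prime p) (pG : is_pgroup G p)
  (RG_WsqrtJU : WsqrtJU (group_ring R G))
  (three_J : jacobson (3%:R : R)%R) :
  is_pgroup G 3.
Proof.
have [<- //|p_neq3] := eqVneq p 3%N.
move=> x; exists 0%N; have [k [_ xk _]] := pG x.
have pk3 : coprime (p ^ k) 3.
  by rewrite coprimeXl // prime_coprime // dvdn_prime2.
have -> : x = 1%g by apply: (torsion_coprime3_eq1 RG_WsqrtJU three_J pk3 xk).
by split=> //; rewrite expg1n.
Qed.
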